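(* Let $a,b$ be positive integers and let $\{F_n(q)\}_{n\geq 0}$ be the $q$-biperiodic Fibonacci sequence. For every integer $n\geq 0$, $$F_n(q)=a^{\xi(n-1)}\sum_{l=0}^{\left\lfloor\frac{n-1}{2}\right\rfloor}{n-l-1 \brack l}(ab)^{\left\lfloor\frac{n-1}{2}\right\rfloor-l}q^{l^2}.$$
   Context: Fix positive integers $a,b$; $q$ is an indeterminate. The $q$-biperiodic Fibonacci sequence is defined by $F_0(q)=0$, $F_1(q)=1$ and, for $n\geq 2$, $F_n(q)=aF_{n-1}(q)+q^{n-2}F_{n-2}(q)$ if $n$ is even, $F_n(q)=bF_{n-1}(q)+q^{n-2}F_{n-2}(q)$ if $n$ is odd. For an integer $n$, $\xi(n)=n-2\lfloor n/2\rfloor$ (so $\xi(n)=0$ if $n$ is even and $1$ if $n$ is odd). The $q$-binomial coefficient is ${n\brack k}=\frac{[n]_q!}{[k]_q!\,[n-k]_q!}$ for $0\leq k\leq n$ (and $0$ for $k<0$ or $k>n\ge 0$), where $[n]_q=1+q+\cdots+q^{n-1}$ and $[n]_q!=[1]_q[2]_q\cdots[n]_q$, $[0]_q!=1$. Empty sums are $0$. *)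

(* Defs.v *)
From HB Require Import structures.
From mathcomp Require Import all_boot all_order all_algebra.

Set Implicit Arguments.
Unset Strict Implicit.
Unset Printing Implicit Defensive.

Import Order.TTheory GRing.Theory Num.Theory.
Local Open Scope ring_scope.

(* The indeterminate q is 'X : {poly int}; the q-binomial coefficients are     *)
(* quotients, so they live in the field of fractions Q(q) of Z[q].             *)
Notation Zq := {poly int}.
Notation Qq := {fraction {poly int}}.

Fixpoint qbifib (a b n : nat) : Zq :=
  match n with
  | 0 => 0
  | n1.+1 =>
    match n1 with
    | 0 => 1
    | n2.+1 =>
      (if odd n then b else a)%:R * qbifib a b n1 + 'X^n2 * qbifib a b n2
    end
  end.

Definition xi (n : int) : int := n - 2 * (n %/ 2)%Z.

Definition qnum (n : nat) : Zq := \sum_(0 <= i < n) 'X^i.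

Definition qfact (n : nat) : Zq := \prod_(1 <= i < n.+1) qnum i.

Definition qbinom (n k : nat) : Qq :=
  if (k <= n)%N then
    tofrac (qfact n) / (tofrac (qfact k) * tofrac (qfact (n - k)))
  else 0.

(* The sum over 0 <= l <= m for an integer upper bound m, empty when m < 0.    *)
Definition sum_to (m : int) (F : nat -> Qq) : Qq :=
  match m with
  | Posz k => \sum_(0 <= l < k.+1) F l
  | Negz _ => 0
  end.

(* Main.v *)
Require Import Defs.
From HB Require Import structures.
From mathcomp Require Import all_boot all_order all_algebra.
From mathcomp Require Import zify ring.

Import Order.TTheory GRing.Theory Num.Theory.
Local Open Scope ring_scope.

(** By the q-Pascal rule [M+1,j+1] = [M,j+1] + q^(M-j) [M,j], the sums
    S_N,k = sum_(l <= k) [N-l,l] t^(k-l) q^(l^2) with t = ab satisfy the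
    three-term recurrence S_(N+2,k+1) = S_(N+1,k+1) + q^(N+1) S_(N,k).  Since
    F_(2k+1) = S_(2k,k) and F_(2k+2) = a S_(2k+1,k), this is the recurrence of
    the q-biperiodic Fibonacci sequence. *)

Lemma qnumD (m n : nat) : qnum (m + n) = qnum m + 'X^m * qnum n.
Proof.
rewrite /qnum !big_mkord big_split_ord /= big_distrr /=.
by congr (_ + _); apply: eq_bigr => i _; rewrite exprD.
Qed.

(** Evaluation at q = 1 gives the nonzero integer n + 1. *)
Lemma qnumS_neq0 (n : nat) : qnum n.+1 != 0.
Proof.
apply/negP => /eqP/(congr1 (horner^~ 1)); rewrite /qnum horner0 horner_sum.
under eq_bigr do rewrite hornerXn expr1n.
by rewrite sumr_const_nat => /eqP; rewrite subn0 pnatr_eq0.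
Qed.

Lemma qfactS (n : nat) : qfact n.+1 = qfact n * qnum n.+1.
Proof. by rewrite /qfact big_nat_recr. Qed.

Lemma qfact_neq0 (n : nat) : qfact n != 0.
Proof.
elim: n => [|n IHn]; first by rewrite /qfact big_geq ?oner_eq0.
by rewrite qfactS mulf_neq0 ?qnumS_neq0.
Qed.

Lemma tofrac_qfact_neq0 (n : nat) : tofrac (qfact n) != 0.
Proof. by rewrite tofrac_eq0 qfact_neq0. Qed.

Lemma qbinom0 (n : nat) : qbinom n 0 = 1.
Proof.
rewrite /qbinom leq0n subn0 {2}/qfact big_geq // tofrac1 mul1r.
by rewrite divff ?tofrac_qfact_neq0.
Qed.

Lemma qbinomn (n : nat) : qbinom n n = 1.
Proof.
rewrite /qbinom leqnn subnn {3}/qfact big_geq // tofrac1 mulr1.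
by rewrite divff ?tofrac_qfact_neq0.
Qed.

Lemma qbinom_small (n k : nat) : (n < k)%N -> qbinom n k = 0.
Proof. by rewrite /qbinom ltnNge => /negbTE ->. Qed.

(* Kept over an abstract field because [field] does not terminate in
   reasonable time over the concrete type [Qq]. *)
Lemma pascal_fraction (F : fieldType) (x y z u v w : F) :
    x != 0 -> u != 0 -> v != 0 -> w != 0 ->
  y * (x + z * w) / (u * w * (v * x)) =
    y / (u * w * v) + z * (y / (u * (v * x))).
Proof. by move=> x0 u0 v0 w0; field; rewrite x0 u0 v0 w0. Qed.

(** Splitting the top factor as [m+1] = [m-j] + q^(m-j) [j+1] cancels one factor of the denominator
    in each summand. *)
Lemma qbinomS (m j : nat) : (j <= m)%N ->
  qbinom m.+1 j.+1 = qbinom m j.+1 + tofrac 'X ^+ (m - j) * qbinom m j.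
Proof.
(* For j = m the term [qbinom m j.+1] is 0 by convention, not a quotient of factorials. *)
rewrite leq_eqVlt => /orP[/eqP <-|lt_jm].
  by rewrite (qbinom_small j j.+1) // !qbinomn subnn expr0 mul1r add0r.
(* Now m - j = d + 1 is a successor, so its factorial can be unfolded. *)
have [d ->] : exists d, m = (j + d).+1 by exists (m - j.+1)%N; lia.
rewrite /qbinom !ltnS leq_addr leqW ?leq_addr //.
have -> : ((j + d).+2 - j.+1 = d.+1)%N by lia.
have -> : ((j + d).+1 - j.+1 = d)%N by lia.
have -> : ((j + d).+1 - j = d.+1)%N by lia.
have qnum_split : qnum (j + d).+2 = qnum d.+1 + 'X^(d.+1) * qnum j.+1.
  by rewrite -qnumD; congr qnum; lia.
rewrite (qfactS (j + d).+1) qnum_split (qfactS j) (qfactS d).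
rewrite !tofracM tofracD tofracM tofracXn.
by apply: pascal_fraction; rewrite ?tofrac_qfact_neq0 // tofrac_eq0 qnumS_neq0.
Qed.

Definition qfib_sum (t : Qq) (N k : nat) : Qq :=
  \sum_(0 <= l < k.+1)
    qbinom (N - l) l * t ^+ (k - l) * tofrac 'X ^+ (l ^ 2).

(** The terms l = 0 agree; q-Pascal splits each term l = j + 1. The bound 2k <= N gives j <= N - j,
    as q-Pascal requires. *)
Lemma qfib_sum_rec (t : Qq) (N k : nat) : (k.*2 <= N)%N ->
  qfib_sum t N.+2 k.+1 =
    qfib_sum t N.+1 k.+1 + tofrac 'X ^+ N.+1 * qfib_sum t N k.
Proof.
move=> le_2k_N; rewrite /qfib_sum.
rewrite big_nat_recl // [in RHS]big_nat_recl // !qbinom0 -addrA.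
congr (_ + _); rewrite big_distrr -big_split /= !big_nat.
apply: eq_bigr => j /andP[_ lt_jk].
rewrite !subSS subSn ?qbinomS; [|lia|lia].
(* The powers of q match since (N - 2j) + (j + 1)^2 = (N + 1) + j^2. *)
have -> : (j.+1 ^ 2 = j ^ 2 + j.*2.+1)%N by lia.
have -> : (N.+1 = (N - j - j) + j.*2.+1)%N by lia.
by rewrite !exprD; ring.
Qed.

(** The extra term l = k + 1 contains [k, k+1] = 0, and every other term gains one factor t. *)
Lemma qfib_sum_doubleS (t : Qq) (k : nat) :
  qfib_sum t k.*2.+1 k.+1 = t * qfib_sum t k.*2.+1 k.
Proof.
rewrite {1}/qfib_sum big_nat_recr //= qbinom_small; last by lia.
rewrite !mul0r addr0 /qfib_sum big_distrr /= !big_nat.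
apply: eq_bigr => l /andP[_ lt_lk].
by rewrite (@subSn l k) // exprS; ring.
Qed.

Lemma tofrac_qbifibSS (a b n : nat) :
  tofrac (qbifib a b n.+2) =
    (if odd n then b else a)%:R * tofrac (qbifib a b n.+1) +
    tofrac 'X ^+ n * tofrac (qbifib a b n).
Proof.
have -> : qbifib a b n.+2 =
    (if odd n then b else a)%:R * qbifib a b n.+1 + 'X^n * qbifib a b n.
  by rewrite /= negbK.
by rewrite tofracD !tofracM tofracXn tofracMn tofrac1.
Qed.

(** Both parities are proved in one induction, as each step uses the two preceding values. In the
    odd step, b times the factor a of the even case produces t. *)
Lemma tofrac_qbifib_double (a b k : nat) :
  let t : Qq := a%:R * b%:R in
  tofrac (qbifib a b k.*2.+1) = qfib_sum t k.*2 k /\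
  tofrac (qbifib a b k.*2.+2) = a%:R * qfib_sum t k.*2.+1 k.
Proof.
move=> t; elim: k => [|k [IHodd IHeven]].
  rewrite /qfib_sum !big_nat1 !subn0 !qbinom0 expr0 !mul1r.
  by rewrite /= mulr0 addr0 mulr1 tofracMn tofrac1 exp0n // expr0 mulr1.
have odd_case : tofrac (qbifib a b k.+1.*2.+1) = qfib_sum t k.+1.*2 k.+1.
  rewrite doubleS tofrac_qbifibSS ifT ?oddS ?odd_double // IHodd IHeven.
  by rewrite qfib_sum_rec // qfib_sum_doubleS mulrA [b%:R * _]mulrC.
split=> //.
rewrite tofrac_qbifibSS ifF ?odd_double // odd_case doubleS IHeven.
by rewrite (qfib_sum_rec t k.*2.+1) ?leqnSn // mulrDr mulrCA.
Qed.

Lemma qfib_sumE (t : Qq) (n k : nat) :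
  qfib_sum t n k =
    sum_to k%:Z (fun l => qbinom (n.+1 - l - 1) l * t ^ (k%:Z - l%:Z) *
      tofrac 'X ^+ (l ^ 2)).
Proof.
rewrite /qfib_sum /= !big_nat; apply: eq_bigr => l /andP[_ lt_lk].
by rewrite subn1 -subSKn subzn.
Qed.

Theorem theorem1 (a b : nat) (ha : (0 < a)%N) (hb : (0 < b)%N) (n : nat) :
  tofrac (qbifib a b n) =
    (a%:R : Qq) ^ xi (n%:Z - 1) *
    sum_to ((n%:Z - 1) %/ 2)%Z (fun l : nat =>
      qbinom (n - l - 1) l *
      ((a%:R * b%:R : Qq) ^ (((n%:Z - 1) %/ 2)%Z - l%:Z)) *
      tofrac 'X ^+ (l ^ 2)).
Proof.
(* For n = 0 the upper limit is the floor of -1/2, that is -1, so the sum is empty. *)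
case: n => [|n]; first by rewrite /= mulr0 tofrac0.
have [k nE] : exists k, n = (odd n + k.*2)%N.
  by exists n./2; rewrite odd_double_half.
have -> : n.+1%:Z - 1 = n%:Z by lia.
have half_n : (n%:Z %/ 2)%Z = k%:Z by lia.
rewrite /xi half_n -qfib_sumE.
have [odd_n even_n] := tofrac_qbifib_double a b k.
case: (odd n) nE => /= nE.
  have -> : n%:Z - 2 * k%:Z = 1 by lia.
  by rewrite expr1z nE.
have -> : n%:Z - 2 * k%:Z = 0 by lia.
by rewrite expr0z mul1r nE.
Qed.
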